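(* Let $n\geq 2$ be an integer and let $\mathbb{F}$ be a field with $\operatorname{char}(\mathbb{F})=2$ and $|\mathbb{F}|\geq 2\lfloor\frac{n}{2}\rfloor+2$. Then every matrix in $SL_n(\mathbb{F})$ is a product of at most two commutators of $\mathcal{U}_2$-matrices, and is a product of at most four $\mathcal{U}_2$-matrices.
   Context: $SL_n(\mathbb{F})$ is the group of $n\times n$ matrices over $\mathbb F$ with determinant $1$. The field may be finite or infinite; infinite fields satisfy any lower bound on $|\mathbb F|$. A matrix $X\in M_n(\mathbb{F})$ is a $\mathcal{U}_2$-matrix (unipotent matrix of index $2$) if $(X-I_n)^2=0_n$ and $X\neq I_n$. For invertible $X,Y$, $[X,Y]:=XYX^{-1}Y^{-1}$. A commutator of $\mathcal{U}_2$-matrices is a matrix of the form $[X,Y]$ where both $X,Y\in M_n(\mathbb{F})$ are $\mathcal{U}_2$-matrices. $\lfloor x\rfloor$ denotes the floor of $x$. *)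

(* Defs.v *)
From mathcomp Require Import all_boot all_order all_algebra.
Set Implicit Arguments.
Unset Strict Implicit.
Unset Printing Implicit Defensive.
Import GRing.Theory.
Local Open Scope ring_scope.

(* |F| >= k, where F may be infinite: F has at least k distinct elements. *)
Definition card_at_least (T : eqType) (k : nat) : Prop :=
  exists s : seq T, uniq s /\ size s = k.

Definition SL_mx (F : fieldType) (n : nat) (A : 'M[F]_n) : Prop := \det A = 1.

Definition U2_mx (F : fieldType) (n : nat) (X : 'M[F]_n) : Prop :=
  (X - 1%:M) *m (X - 1%:M) = 0 /\ X <> 1%:M.

(* This is [X, Y] only for invertible X and Y, as invmx is the identity on
   singular matrices; U2-matrices are invertible. *)
Definition commutator_mx (F : fieldType) (n : nat) (X Y : 'M[F]_n) : 'M[F]_n :=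
  X *m Y *m invmx X *m invmx Y.

Definition U2_commutator (F : fieldType) (n : nat) (A : 'M[F]_n) : Prop :=
  exists X Y : 'M[F]_n, [/\ U2_mx X, U2_mx Y & A = commutator_mx X Y].

(* Products have at least one factor, so the identity matrix is not covered
   by the empty product. *)
Definition product_of_at_most (F : fieldType) (n k : nat)
    (P : 'M[F]_n -> Prop) (A : 'M[F]_n) : Prop :=
  exists s : seq 'M[F]_n,
    [/\ (0 < size s <= k)%N, (forall B, B \in s -> P B)
      & A = \big[mulmx/1%:M]_(B <- s) B].

(* Main.v *)
(** In characteristic 2 the U_2-matrices are the nontrivial involutions, so
    their commutators are the squares (XY)^2.  If s is a nontrivial involution
    of the indices and d_i d_(s i) = 1, then X = diag(d) P_s and Y = P_s show
    that diag(d_i^2) is such a commutator.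

    A nonscalar A of determinant 1 is conjugate to LU with L, U
    unitriangular, hence to (L D)(D^-1 U) for every invertible diagonal D.
    The bound on |F| provides D = diag(d_i^2) with distinct entries and
    d_i d_(n-1-i) = 1; then L D and D^-1 U are triangular with distinct
    diagonal entries, so they are conjugate to D and D^-1.

    For a scalar matrix l I we have l^n = 1 and l = v^2 for some v, and
    l I = diag((v l^i)^2) diag((l^-i)^2), where the involutions are
    i -> n-1-i and i -> -i mod n; the latter is nontrivial for n > 2. *)
Require Import Defs.
From mathcomp Require Import all_boot all_order all_algebra ring zify.
Set Implicit Arguments.
Unset Strict Implicit.
Unset Printing Implicit Defensive.
Import GRing.Theory.
Local Open Scope ring_scope.

(** * Involutions and their commutators in characteristic 2 *)

Lemma U2_mxE (F : fieldType) (n : nat) (X : 'M[F]_n) :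
  2%N \in [pchar F] -> U2_mx X <-> X *m X = 1%:M /\ X <> 1%:M.
Proof.
move=> F2; rewrite /U2_mx.
have -> : (X - 1%:M) *m (X - 1%:M) = X *m X - 1%:M.
  rewrite mulmxBl !mulmxBr !mul1mx mulmx1 opprB -addrA; congr (_ + _).
  rewrite addrCA; apply/matrixP=> i j.
  by rewrite !mxE -opprD addrr_pchar2 // subr0 oppr_pchar2.
by split=> [[/eqP XX nX]|[-> nX]]; rewrite ?subrr //; move: XX;
  rewrite subr_eq0 => /eqP.
Qed.

Lemma U2_commutatorE (F : fieldType) (n : nat) (A : 'M[F]_n) :
  2%N \in [pchar F] ->
  U2_commutator A <->
  exists X Y : 'M[F]_n, [/\ U2_mx X, U2_mx Y & A = (X *m Y) *m (X *m Y)].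
Proof.
move=> F2.
have invK (X : 'M[F]_n) : U2_mx X -> invmx X = X.
  case/(U2_mxE X F2) => XX _; have [uX _] := mulmx1_unit XX.
  by rewrite -[LHS]mulmx1 -XX mulKmx.
by split=> -[X [Y [UX UY ->]]]; exists X, Y; split=> //;
  rewrite /commutator_mx !invK // !mulmxA.
Qed.

Lemma U2_mx_conj (F : fieldType) (n : nat) (P X : 'M[F]_n) :
  2%N \in [pchar F] -> P \in unitmx -> U2_mx X -> U2_mx (P *m X *m invmx P).
Proof.
move=> F2 uP /(U2_mxE X F2) [XX nX]; apply/(U2_mxE _ F2); split.
  by rewrite !mulmxA mulmxKV // -(mulmxA P) XX mulmx1 mulmxV.
move=> E; apply: nX.
by rewrite -[X](mulKmx uP) -[P *m X](mulmxKV uP) E mul1mx mulVmx.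
Qed.

Lemma U2_commutator_conj (F : fieldType) (n : nat) (P A : 'M[F]_n) :
  2%N \in [pchar F] -> P \in unitmx ->
  U2_commutator A -> U2_commutator (P *m A *m invmx P).
Proof.
move=> F2 uP /(U2_commutatorE A F2) [X [Y [UX UY ->]]].
apply/(U2_commutatorE _ F2).
exists (P *m X *m invmx P), (P *m Y *m invmx P).
by split; rewrite ?mulmxA ?mulmxKV //; exact: U2_mx_conj.
Qed.

Lemma U2_mx_tr (F : fieldType) (n : nat) (X : 'M[F]_n) : U2_mx X -> U2_mx X^T.
Proof.
move=> [XX nX]; rewrite /U2_mx -[1%:M]trmx1 -linearB /= -trmx_mul XX trmx0.
by split=> // /trmx_inj.
Qed.

(** Reduces upper triangular matrices to lower triangular ones; transposition reverses products, so
    the two involutions swap places. *)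
Lemma U2_commutator_tr (F : fieldType) (n : nat) (A : 'M[F]_n) :
  2%N \in [pchar F] -> U2_commutator A^T -> U2_commutator A.
Proof.
move=> F2 /(U2_commutatorE _ F2) [X [Y [UX UY AE]]];
  apply/(U2_commutatorE _ F2).
exists Y^T, X^T; split; try exact: U2_mx_tr.
by rewrite -!trmx_mul -AE trmxK.
Qed.

Lemma U2_commutator_diag (F : fieldType) (n : nat) (s : 'I_n -> 'I_n)
    (i0 : 'I_n) (d : 'I_n -> F) :
  2%N \in [pchar F] -> involutive s -> s i0 != i0 ->
  (forall i, d i * d (s i) = 1) ->
  U2_commutator (diag_mx (\row_i (d i ^+ 2))).
Proof.
move=> F2 sK si0 ds; apply/(U2_commutatorE _ F2).
pose Y := \matrix_(i, j) ((j == s i)%:R : F).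
pose D := diag_mx (\row_i d i).
have mulY (A : 'M_n) i j : (Y *m A) i j = A (s i) j.
  rewrite mxE (bigD1 (s i)) //= mxE eqxx mul1r big1 ?addr0 // => k /negPf nk.
  by rewrite mxE nk mul0r.
have YY : Y *m Y = 1%:M.
  by apply/matrixP=> i j; rewrite mulY !mxE sK eq_sym.
(* Since [s] moves [i0], both involutions have a zero at ([i0], [i0]), which keeps them from being
   the identity. *)
have entry (X : 'M[F]_n) : X i0 i0 = 0 -> X <> 1%:M.
  by move=> X0 /matrixP/(_ i0 i0); rewrite X0 !mxE eqxx => /eqP;
    rewrite eq_sym oner_eq0.
have XE i j : (D *m Y) i j = d i * (j == s i)%:R by rewrite mul_diag_mx !mxE.
have XX : (D *m Y) *m (D *m Y) = 1%:M.
  apply/matrixP=> i j; rewrite -mulmxA mul_diag_mx mxE mulY XE !mxE sK.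
  by rewrite mulrA ds mul1r eq_sym.
exists (D *m Y), Y; split.
- by apply/(U2_mxE _ F2); split=> //; apply: entry;
  rewrite XE eq_sym (negPf si0) mulr0.
- by apply/(U2_mxE _ F2); split=> //; apply: entry;
  rewrite mxE eq_sym (negPf si0).
- rewrite -[D *m Y *m Y]mulmxA YY mulmx1.
  by rewrite mulmx_diag; congr diag_mx; apply/rowP=> i; rewrite !mxE expr2.
Qed.

(** For odd n, l = l^(n+1) is the square of l^((n+1)/2). For even n, injectivity of squaring gives
    l^(n/2) = 1, and n/2 < n. *)
Lemma sqrt_of_root_of_unity (F : fieldType) (n : nat) (l : F) :
  2%N \in [pchar F] -> (0 < n)%N -> l ^+ n = 1 -> exists v, v ^+ 2 = l.
Proof.
move=> F2; have [m] := ubnP n; elim: m n => // m IH n ltnm n0 ln.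
have [on|en] := boolP (odd n).
  have e : (n./2.+1 * 2 = n.+1)%N.
    by rewrite muln2 doubleS -[in RHS](odd_double_half n) on.
  by exists (l ^+ n./2.+1); rewrite -exprM e exprS ln mulr1.
have En : (n = n./2 * 2)%N by rewrite muln2 even_halfK.
have n2 : (0 < n./2)%N by rewrite -(ltn_pmul2r (isT : 0 < 2)%N) -En.
apply: (IH n./2) => //.
  by apply: leq_trans (ltnm : (n <= m)%N); rewrite [X in (_ < X)%N]En ltn_Pmulr.
have /eqP := ln; rewrite {1}En exprM -[X in _ == X](expr1n _ 2).
by move/eqP/(fmorph_inj (pFrobenius_aut F2)).
Qed.

(** * Similarity, and triangular matrices with distinct diagonal entries *)

(** Written without inverses, so that block products verify it directly. *)
Definition conj_mx (F : fieldType) (n : nat) (A B : 'M[F]_n) : Prop :=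
  exists2 P, P \in unitmx & P *m A = B *m P.

Lemma conj_mx_trans (F : fieldType) (n : nat) (A B C : 'M[F]_n) :
  conj_mx A B -> conj_mx B C -> conj_mx A C.
Proof.
move=> [P uP PA] [Q uQ QB]; exists (Q *m P); first by rewrite unitmx_mul uP uQ.
by rewrite -mulmxA PA mulmxA QB mulmxA.
Qed.

Lemma conj_mxE (F : fieldType) (n : nat) (A B : 'M[F]_n) :
  conj_mx A B -> exists2 P, P \in unitmx & A = P *m B *m invmx P.
Proof.
move=> [P uP PA]; exists (invmx P); first by rewrite unitmx_inv.
by rewrite invmxK -mulmxA -PA mulKmx.
Qed.

Lemma det_conj_mx (F : fieldType) (n : nat) (A B : 'M[F]_n) :
  conj_mx A B -> \det A = \det B.
Proof.
move=> /conj_mxE [P uP ->]; rewrite !det_mulmx mulrAC -det_mulmx mulmxV //.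
by rewrite det1 mul1r.
Qed.

Lemma trig_conj_diag (F : fieldType) (n : nat) (T : 'M[F]_n) :
  is_trig_mx T -> injective (fun i => T i i) ->
  conj_mx T (diag_mx (\row_i T i i)).
Proof.
elim: n T => [|n IH]; first by exists 1%:M;
  rewrite ?unitmx1 // [LHS]flatmx0 [RHS]flatmx0.
rewrite -[n.+1]/(1 + n)%N => T; rewrite -[T]submxK.
move: (ulsubmx _) (ursubmx _) (dlsubmx _) (drsubmx _) => a r c T1 {T}.
rewrite is_trig_block_mx // => /and3P[/eqP -> _ tT1] injT.
have [|Q uQ QT] := IH T1 tT1.
  move=> i j e; apply: (@rshift_inj 1 n); apply: injT.
  by rewrite !block_mxEdr.
have da i : T1 i i - a 0 0 != 0.
  rewrite subr_eq0; apply/eqP=> e.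
  have /eqP : rshift 1 i = lshift n 0.
    by apply: injT; rewrite block_mxEdr block_mxEul.
  by rewrite eq_rlshift.
have -> : diag_mx (\row_i block_mx a 0 c T1 i i) =
    block_mx a 0 0 (diag_mx (\row_i T1 i i)).
  have -> : \row_i block_mx a 0 c T1 i i = row_mx a (\row_i T1 i i).
    apply/rowP=> i; rewrite -[i]splitK mxE; case: (split i) => j /=.
      by rewrite block_mxEul row_mxEl !ord1.
    by rewrite block_mxEdr row_mxEr mxE.
  by rewrite diag_mx_row; congr block_mx; apply/matrixP=> i j;
    rewrite !ord1 !mxE eqxx.
(* [y] solves y a + Q c = diag(T1) y, the lower left block of the conjugation equation; distinct
   diagonal entries make the divisors nonzero. *)
pose y := \col_i ((Q *m c) i 0 / (T1 i i - a 0 0)).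
exists (block_mx 1%:M 0 y Q).
  by rewrite unitmxE det_lblock det1 mul1r -unitmxE.
rewrite !mulmx_block !mul0mx !mulmx0 !mul1mx mulmx1 !addr0 !add0r QT.
congr block_mx; apply/colP=> i; rewrite mul_diag_mx !mxE big_ord1 !mxE.
by set q := \sum_k _; field.
Qed.

(** * Nonscalar matrices of determinant 1 are similar to products LU *)

(** If all e_i are row eigenvectors, then A is diagonal; if all e_i + e_j are too, its diagonal
    entries agree. *)
Lemma exists_noneigen_row (F : fieldType) (n : nat) (A : 'M[F]_n) :
  ~~ is_scalar_mx A -> exists v : 'rV_n, ~~ (v *m A <= v)%MS.
Proof.
case: n A => [|n] A nA; first by rewrite /is_scalar_mx insubF in nA.
have [/existsP[i hi]|/existsPn e1] :=
    boolP [exists i, ~~ ((delta_mx 0 i : 'rV_n.+1) *m A <= (delta_mx 0 i :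
      'rV_n.+1))%MS].
  by exists (delta_mx 0 i).
pose e2 i j : 'rV[F]_n.+1 := delta_mx 0 i + delta_mx 0 j.
have [/existsP[i /existsP[j hij]]|/existsPn h2] :=
    boolP [exists i, exists j, ~~ (e2 i j *m A <= e2 i j)%MS].
  by exists (e2 i j).
case/negP: nA; apply/is_scalar_mxP; exists (A 0 0).
have offd i j : i != j -> A i j = 0.
  move=> nij; have := e1 i; rewrite negbK => /sub_rVP[a].
  by rewrite -rowE => /rowP/(_ j); rewrite !mxE eqxx eq_sym (negPf nij) mulr0.
apply/matrixP=> i j; rewrite !mxE; have [<-|/offd -> //] := eqVneq i j.
rewrite mulr1n; have [-> //|ni0] := eqVneq i 0.
have := h2 i => /existsPn/(_ 0); rewrite negbK => /sub_rVP[a].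
rewrite mulmxDl -!rowE => /rowP eA; move: (eA i) (eA 0); rewrite !mxE !eqxx.
rewrite (eq_sym 0 i) (negPf ni0) (offd _ _ ni0) (offd 0 i) 1?eq_sym //.
by rewrite !add0r !addr0 => -> ->.
Qed.

Lemma conj_corner1 (F : fieldType) (m : nat) (A : 'M[F]_(1 + m)) :
  ~~ is_scalar_mx A ->
  exists (r : 'rV_m) (c : 'cV_m) (D : 'M_m),
    r != 0 /\ conj_mx A (block_mx 1%:M r c D).
Proof.
move=> /exists_noneigen_row [v nv].
have nv0 : v != 0 by apply: contraNneq nv => ->; rewrite mul0mx sub0mx.
pose e : 'rV[F]_(1 + m) := row_mx 1%:M 0.
have ee : e *m e^T = 1%:M.
  by rewrite tr_row_mx mul_row_col trmx1 trmx0 mul1mx mul0mx addr0.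
have rke : \rank e = 1.
  by apply/eqP; rewrite -[_ == _]/(row_free e); apply/row_freeP; exists e^T.
(* [g] is an invertible matrix with first row [v]. *)
have [|g ug] := @complete_unitmx _ _ _ e (e^T *m v).
  by rewrite mulmxA ee mul1mx rank_rV nv0 rke.
rewrite mulmxA ee mul1mx => eg.
have gA : g *m A = g *m A *m invmx g *m g by rewrite mulmxKV.
rewrite -(submxK (g *m A *m _)) in gA.
move: gA; move: (ulsubmx _) (ursubmx _) (dlsubmx _) (drsubmx _) => a r c D gA.
(* If r = 0, then v A = a v, against the choice of [v]. *)
have r0 : r != 0.
  apply: contraNneq nv => r0; apply/sub_rVP; exists (a 0 0).
  rewrite eg -mulmxA gA mulmxA mul_row_block !mul1mx !mul0mx !addr0 r0.
  by rewrite -[a in LHS]mulmx1 (mx11_scalar a) -[X in row_mx _ X](scaler0 _ (a 0 0))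
    mul_scalar_mx -scale_row_mx -scalemxAl mxE eqxx mulr1n.
have /rV0Pn[j rj] := r0.
(* Conjugation by the lower transvection of [y] turns the corner a into a - r y, so r y = a - 1 is
   wanted. *)
pose y : 'cV_m := ((a 0 0 - 1) / r 0 j) *: delta_mx j 0.
have ry : r *m y = a - 1%:M.
  rewrite -scalemxAr -colE; apply/matrixP=> i k; rewrite !ord1 !mxE.
  by rewrite mulfVK.
exists r, (y *m a + c - (y *m r + D) *m y), (y *m r + D); split=> //.
apply: (@conj_mx_trans _ _ _ (block_mx a r c D)); first by exists g.
exists (block_mx 1%:M 0 y 1%:M).
  by rewrite unitmxE det_lblock !det1 mulr1 unitr1.
rewrite !mulmx_block !mul1mx !mul0mx !mulmx1 !mulmx0 !addr0 !add0r ry.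
by rewrite (addrC 1%:M) !subrK.
Qed.

(** Block LU factorization, with [D - c *m r] the Schur complement of the corner. *)
Lemma det_corner1 (F : fieldType) (m : nat) (r : 'rV[F]_m) (c : 'cV_m)
    (D : 'M_m) :
  \det (block_mx 1%:M r c D) = \det (D - c *m r).
Proof.
have -> : block_mx 1%:M r c D =
    block_mx 1%:M 0 c 1%:M *m block_mx 1%:M r 0 (D - c *m r).
  by rewrite mulmx_block !mul1mx !mul0mx !mulmx1 !addr0 addrC subrK.
by rewrite det_mulmx det_lblock det_ublock !det1 !mul1r.
Qed.

(* If the Schur complement is a scalar a I with a != 1, conjugation by the
   lower transvection of a column y with r y = 0 turns it into a (I + y r). *)
Lemma conj_corner1_schur (F : fieldType) (m : nat) (A : 'M[F]_(1 + m)) :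
  ~~ is_scalar_mx A -> \det A = 1 ->
  exists (r : 'rV_m) (c : 'cV_m) (D : 'M_m),
    conj_mx A (block_mx 1%:M r c D) /\
    (is_scalar_mx (D - c *m r) -> D - c *m r = 1%:M).
Proof.
move=> nA dA; have [r [c [D [r0 cA]]]] := conj_corner1 nA.
have dS : \det (D - c *m r) = 1 by rewrite -det_corner1 -(det_conj_mx cA).
have [/is_scalar_mxP[a Sa]|nS] := boolP (is_scalar_mx (D - c *m r)); last first.
  by exists r, c, D; split=> //; rewrite (negPf nS).
have /rV0Pn[j rj] := r0.
(* Without a second index m = 1, and determinant 1 forces a = 1. *)
have [k kj|one] := pickP [pred k | k != j]; last first.
  exists r, c, D; split=> // _; move: dS; rewrite Sa.
  have m1 : m = 1.
    by rewrite -[m]card_ord; apply/eqP/fintype1P; exists j => k;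
      apply/eqP/negbFE/one.
  by subst m; rewrite det_scalar1 => ->.
have a0 : a != 0.
  apply: contra_eq_neq dS => a0.
  have m0 : (0 < m)%N by case: (j) => ? /(leq_ltn_trans (leq0n _)).
  by rewrite Sa a0 det_scalar expr0n eqn0Ngt m0 eq_sym oner_eq0.
pose y : 'cV_m := r 0 j *: delta_mx k 0 - r 0 k *: delta_mx j 0.
have ry : r *m y = 0.
  rewrite mulmxBr -!scalemxAr -!colE; apply/matrixP=> i l.
  by rewrite !ord1 !mxE mulrC subrr.
have yk : y k 0 != 0 by rewrite !mxE !eqxx (negPf kj) mulr1 mulr0 subr0.
clearbody y.
have DE : D = c *m r + a%:M by rewrite -Sa addrC subrK.
have Dy : D *m y = a *: y.
  by rewrite DE mulmxDl -mulmxA ry mulmx0 add0r mul_scalar_mx.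
exists r, (y + c - (y *m r + D) *m y), (y *m r + D); split.
  apply: conj_mx_trans cA _; exists (block_mx 1%:M 0 y 1%:M).
    by rewrite unitmxE det_lblock !det1 mulr1 unitr1.
  rewrite !mulmx_block !mul1mx !mul0mx !mulmx1 !mulmx0 !addr0 !add0r ry addr0.
  by rewrite subrK.
have -> : y *m r + D - (y + c - (y *m r + D) *m y) *m r = a%:M + a *: (y *m r).
  rewrite (mulmxDl (y *m r)) -mulmxA ry mulmx0 add0r Dy mulmxBl mulmxDl.
  rewrite -scalemxAl DE.
  by move: (y *m r) (c *m r) a%:M => z w t; apply/matrixP=> i l; rewrite !mxE;
    ring.
(* The new complement is never scalar: otherwise a y r would be a scalar matrix of square zero,
   hence zero, yet its (k, j) entry is a y_k r_j != 0. *)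
case/is_scalar_mxP=> b yb.
have yrE : a *: (y *m r) = (b - a)%:M by rewrite raddfB /= -yb addrC addKr.
have /eqP : (a *: (y *m r)) *m (a *: (y *m r)) = 0.
  by rewrite -scalemxAl -scalemxAr mulmxA -(mulmxA y) ry mulmx0 mul0mx !scaler0.
rewrite yrE -scalar_mxM => /eqP/matrixP/(_ k k).
rewrite !mxE eqxx mulr1n => /eqP; rewrite mulf_eq0 orbb => /eqP ba.
move: yrE; rewrite ba => /matrixP/(_ k j); rewrite !mxE big_ord1 mul0rn => /eqP.
by rewrite !mulf_eq0 (negPf a0) (negPf yk) (negPf rj).
Qed.

(** Lower unitriangular, as [is_trig_mx] means lower triangular; the upper case is expressed through
    the transpose. *)
Definition unitrig_mx (F : fieldType) (n : nat) (L : 'M[F]_n) : Prop :=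
  is_trig_mx L /\ forall i, L i i = 1.

Lemma unitrig_mx1 (F : fieldType) (n : nat) : unitrig_mx (1%:M : 'M[F]_n).
Proof. by split=> [|i]; rewrite ?scalar_mx_is_trig // mxE eqxx. Qed.

Lemma unitrig_block_mx (F : fieldType) (m : nat) (c : 'cV[F]_m) (L : 'M_m) :
  unitrig_mx L -> @unitrig_mx F (1 + m) (block_mx 1%:M 0 c L).
Proof.
move=> [tL L1]; split;
  first by rewrite is_trig_block_mx // eqxx scalar_mx_is_trig.
move=> i; rewrite -[i]splitK; case: (split i) => k /=.
  by rewrite block_mxEul mxE eqxx.
by rewrite block_mxEdr.
Qed.

(** Induction on the size through the Schur complement. The condition on scalar matrices is the form
    that the complement inherits. *)
Lemma conj_unitrig_mul (F : fieldType) (n : nat) (A : 'M[F]_n) :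
  \det A = 1 -> (is_scalar_mx A -> A = 1%:M) ->
  exists L U : 'M_n, [/\ unitrig_mx L, unitrig_mx U^T & conj_mx A (L *m U)].
Proof.
elim: n A => [|n IH].
  move=> A _ _; exists 1%:M, 1%:M; rewrite trmx1; split; try exact: unitrig_mx1.
  by exists 1%:M; rewrite ?unitmx1 // [LHS]flatmx0 [RHS]flatmx0.
rewrite -[n.+1]/(1 + n)%N => A dA sA.
have [/sA ->|nA] := boolP (is_scalar_mx A).
  exists 1%:M, 1%:M; rewrite trmx1 mulmx1; split; try exact: unitrig_mx1.
  by exists 1%:M; rewrite ?unitmx1.
have [r [c [D [cA]]]] := conj_corner1_schur nA dA.
set S := D - c *m r => S1.
have [|L [U [tL tU [Q uQ QS]]]] := IH S _ S1.
  by rewrite -det_corner1 -(det_conj_mx cA).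
(* Conjugation by diag(1, Q) gives the lower right block Q S Q^-1 + (Q c)(r Q^-1), where Q S Q^-1 =
   L U. *)
exists (block_mx 1%:M 0 (Q *m c) L), (block_mx 1%:M (r *m invmx Q) 0 U); split.
- exact: unitrig_block_mx.
- by rewrite tr_block_mx trmx1 trmx0; exact: unitrig_block_mx.
apply: conj_mx_trans cA _; exists (block_mx 1%:M 0 0 Q).
  by rewrite unitmxE det_lblock det1 mul1r -unitmxE.
rewrite !mulmx_block !mul1mx !mul0mx !mulmx1 !mulmx0 !addr0 !add0r.
rewrite mulmxKV // mulmxDl -QS !mulmxA mulmxKV //.
by rewrite /S mulmxBr mulmxA addrC subrK.
Qed.

(** * Distinct diagonal entries in mutually inverse pairs *)

Lemma sqrf_inj_pchar2 (F : fieldType) :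
  2%N \in [pchar F] -> injective (fun x : F => x ^+ 2).
Proof. by move=> F2 x y; apply: (fmorph_inj (pFrobenius_aut F2)). Qed.

(** Greedy choice: each x taken discards at most x and x^-1. These differ, since x^2 = 1 only for x
    = 1 in characteristic 2. *)
Lemma uniq_inverse_pairs (F : fieldType) (k : nat) (s : seq F) :
  2%N \in [pchar F] -> uniq s -> 0 \notin s -> 1 \notin s ->
  (2 * k <= size s)%N ->
  exists t, [/\ size t = k, {subset t <= s} & uniq (t ++ map GRing.inv t)].
Proof.
move=> F2; elim: k s => [|k IH] [|x s] //; try by move=> *; exists [::].
rewrite /= !inE !negb_or => /andP[xs us] /andP[x0 s0] /andP[x1 s1] sz.
have sub : {subset rem x^-1 s <= s} by exact: mem_rem.
have [||||t [st ts ut]] := IH (rem x^-1 s).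
- exact: rem_uniq.
- by apply: contra s0 => /sub.
- by apply: contra s1 => /sub.
- have : (size s <= (size (rem x^-1 s)).+1)%N.
    have [xi|xi] := boolP (x^-1 \in s); last by rewrite rem_id.
    by rewrite size_rem // leqSpred.
  by move: sz; move: (size s) (size (rem _ s)) => a b; lia.
have xt : x \notin t by apply: contra xs => /ts/sub.
have xit : x^-1 \notin t by apply/negP=> /ts; rewrite mem_rem_uniq // !inE eqxx.
exists (x :: t); split; first by rewrite /= st.
  by move=> y; rewrite !inE => /predU1P[->|/ts/sub ->]; rewrite ?eqxx ?orbT.
have memV y : (y \in map GRing.inv t) = (y^-1 \in t).
  by rewrite -[y in LHS]invrK (mem_map invr_inj).
rewrite /= -cat1s uniq_catCA cat1s /= ut !mem_cat !inE !memV invrK.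
rewrite !negb_or xt xit !andbT /=.
apply: contraNneq x1 => xx; have : x ^+ 2 = 1 ^+ 2.
  by rewrite expr1n expr2 {2}xx mulfV // eq_sym.
by move/(sqrf_inj_pchar2 F2) ->.
Qed.

(** Discarding 0 and 1 leaves at least 2 * (n %/ 2) elements, enough for n %/ 2 inverse pairs. *)
Lemma exists_inverse_symmetric (F : fieldType) (n : nat) :
  2%N \in [pchar F] -> card_at_least F (2 * (n %/ 2) + 2) ->
  exists2 d : 'I_n -> F, injective d & forall i, d i * d (rev_ord i) = 1.
Proof.
move=> F2 [s [us ss]].
pose a : pred F := fun x => (x != 0) && (x != 1).
pose s' := filter a s.
have [||||t [st ts ut]] := @uniq_inverse_pairs F n./2 s' F2.
- exact: filter_uniq.
- by rewrite mem_filter /a eqxx.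
- by rewrite mem_filter /a eqxx andbF.
- have sB : (size (filter (predC a) s) <= 2)%N.
    apply: (@uniq_leq_size _ _ [:: 0; 1]); first exact: filter_uniq.
    by move=> x; rewrite mem_filter /= /a negb_and !negbK !inE => /andP[].
  move: (count_predC a s); rewrite -!size_filter ss.
  rewrite -divn2; move: sB; rewrite -/s'.
  by move: (size s') (size (filter _ _)) => b c; lia.
(* Reversing this list inverts its entries; for odd n the middle entry is 1, its own inverse. *)
pose l := t ++ nseq (odd n) 1 ++ rev (map GRing.inv t).
have sl : size l = n.
  by rewrite !size_cat size_nseq size_rev size_map st addnCA addnn
    odd_double_half.
have ul : uniq l.
  have n1 : 1 \notin t by apply/negP=> /ts; rewrite mem_filter /a eqxx andbF.
  rewrite /l uniq_catCA cat_uniq (_ : uniq (t ++ _)); last first.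
    by rewrite (perm_uniq (_ : perm_eq _ (t ++ map GRing.inv t))) //
      perm_cat2l perm_rev.
  rewrite has_sym; case: (odd n) => //=.
  rewrite orbF mem_cat negb_or n1 mem_rev /=.
  by rewrite -[1]invr1 (mem_map invr_inj) n1.
have rl : rev l = map GRing.inv l.
  rewrite !rev_cat revK !map_cat map_rev (mapK (@invrK F)).
  rewrite -catA; congr (_ ++ (_ ++ _)).
  by case: (odd n); rewrite //= /rev /= invr1.
exists (fun i : 'I_n => l`_i).
  by move=> i j /eqP; rewrite nth_uniq ?sl // => /eqP/val_inj.
move=> i; have -> : l`_(rev_ord i) = (l`_i)^-1.
  have := nth_rev 0 (_ : (i < size l)%N); rewrite sl => <- //.
  by rewrite rl (nth_map 0) ?sl.
rewrite mulfV //; have : l`_i \in l by rewrite mem_nth ?sl.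
have t0 : 0 \notin t by apply/negP=> /ts; rewrite mem_filter /a eqxx.
apply: contraTneq => ->; rewrite !mem_cat mem_rev mem_nseq !negb_or t0 /=.
by rewrite eq_sym oner_eq0 andbF -[0 in X in X \notin _]invr0 (mem_map
  invr_inj).
Qed.

(** * Factorizations into commutators and involutions *)

(** Serves the scalar case with n = 2, where only the identity occurs. *)
Lemma U2_commutator1 (F : fieldType) (n : nat) :
  2%N \in [pchar F] -> (2 <= n)%N -> @U2_commutator F n 1%:M.
Proof.
move=> F2; case: n => // n n2.
have := @U2_commutator_diag F n.+1 (@rev_ord _) ord0 (fun=> 1) F2 rev_ordK.
rewrite -val_eqE /= subn1 -lt0n => /(_ n2).
rewrite (_ : diag_mx _ = 1%:M); first by apply=> i; rewrite mulr1.
by rewrite -diag_const_mx; congr diag_mx; apply/rowP=> i; rewrite !mxE expr1n.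
Qed.

Lemma scalar_mul_U2_commutators (F : fieldType) (n : nat) (l : F) :
  2%N \in [pchar F] -> (2 < n)%N -> l ^+ n = 1 ->
  exists A B : 'M[F]_n, [/\ U2_commutator A, U2_commutator B & l%:M = A *m B].
Proof.
case: n => // n F2 n2 ln.
have [v vl] := sqrt_of_root_of_unity F2 (isT : 0 < n.+1)%N ln.
have l0 : l != 0.
  by apply: contra_eq_neq ln => ->; rewrite expr0n eq_sym oner_eq0.
exists (diag_mx (\row_(i < n.+1) ((v * l ^+ i) ^+ 2))).
exists (diag_mx (\row_(i < n.+1) ((l ^- i) ^+ 2))); split.
- apply: (@U2_commutator_diag F n.+1 (@rev_ord _) ord0) => //.
  + exact: rev_ordK.
  + by rewrite -val_eqE /= subn1 -lt0n; apply: ltnW.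
  (* The powers of [l] multiply to [l ^+ n]; the factor [v ^+ 2 = l] completes this to
     [l ^+ n.+1 = 1]. *)
  + move=> i; rewrite mulrACA -expr2 vl -exprD /= subSS subnKC -?exprS //.
    by rewrite -ltnS.
(* Negation on ['I_n.+1] is modular; it moves 1 because the size exceeds 2. *)
- apply: (@U2_commutator_diag F n.+1 (@GRing.opp _) (inord 1)) => //.
  + exact: opprK.
  + rewrite -val_eqE /= inordK; last by rewrite ltnS; apply: ltnW.
    by rewrite subn1 modn_small //= gtn_eqF.
  + move=> i; rewrite -invfM -exprD; apply/eqP;
    rewrite invr_eq1 -(expr_mod _ ln) /=.
    by rewrite modnDmr subnKC ?modnn // ltnW.
- rewrite mulmx_diag -diag_const_mx; congr diag_mx; apply/rowP=> i.
  by rewrite !mxE -exprMn mulfK ?expf_neq0.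
Qed.

Lemma nonscalar_mul_U2_commutators (F : fieldType) (n : nat) (A : 'M[F]_n) :
  (2 <= n)%N -> 2%N \in [pchar F] -> card_at_least F (2 * (n %/ 2) + 2) ->
  ~~ is_scalar_mx A -> \det A = 1 ->
  exists B C : 'M[F]_n, [/\ U2_commutator B, U2_commutator C & A = B *m C].
Proof.
case: n A => // n A n2 F2 cF nA dA.
have [d dI dr] := exists_inverse_symmetric F2 cF.
have d0 i : d i != 0.
  by apply/eqP=> di; move/eqP: (dr i); rewrite di mul0r eq_sym oner_eq0.
have diagU2 (e : 'I_n.+1 -> F) : (forall i, e i * e (rev_ord i) = 1) ->
    U2_commutator (diag_mx (\row_i (e i ^+ 2))).
  apply: (@U2_commutator_diag _ _ _ ord0) => //; first exact: rev_ordK.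
  by rewrite -val_eqE /= subn1 -lt0n.
(* Squaring is injective, so the diagonal entries e_i^2 are distinct and [T] is similar to its
   diagonal part. *)
have trigU2 (e : 'I_n.+1 -> F) (T : 'M[F]_n.+1) : injective e ->
    (forall i, e i * e (rev_ord i) = 1) -> is_trig_mx T ->
    (forall i, T i i = e i ^+ 2) -> U2_commutator T.
  move=> eI er tT Te.
  have [|P uP ->] := conj_mxE (trig_conj_diag tT _).
    by move=> i j; rewrite !Te => /(sqrf_inj_pchar2 F2)/eI.
  apply: U2_commutator_conj => //.
  have -> : \row_i T i i = \row_i (e i ^+ 2) by apply/rowP=> i; rewrite !mxE Te.
  exact: diagU2.
have [|L [U [[tL L1] [tU U1] /conj_mxE [P uP ->]]]] := conj_unitrig_mul dA.
  by rewrite (negPf nA).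
pose D := diag_mx (\row_i (d i ^+ 2));
  pose E := diag_mx (\row_i ((d i)^-1 ^+ 2)).
have DE : D *m E = 1%:M.
  rewrite mulmx_diag -diag_const_mx; congr diag_mx; apply/rowP=> i.
  by rewrite !mxE -exprMn mulfV // expr1n.
exists (P *m (L *m D) *m invmx P), (P *m (E *m U) *m invmx P); split.
- apply: U2_commutator_conj => //; apply: (trigU2 d) => //.
    apply/is_trig_mxP=> i j ij; rewrite mul_mx_diag mxE.
    by rewrite (is_trig_mxP tL) // mul0r.
  by move=> i; rewrite mul_mx_diag !mxE L1 mul1r.
(* [E *m U] is upper triangular with diagonal d_i^-2, so its transpose is treated with e_i =
   d_i^-1. *)
- apply: U2_commutator_conj => //; apply/U2_commutator_tr => //.
  apply: (trigU2 (fun i => (d i)^-1)) => //.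
  + by move=> i j /invr_inj/dI.
  + by move=> i; rewrite -invfM dr invr1.
  + apply/is_trig_mxP=> i j ij; rewrite mxE mul_diag_mx mxE.
    by have := is_trig_mxP tU i j ij; rewrite mxE => ->; rewrite mulr0.
  + by move=> i; rewrite mxE mul_diag_mx !mxE; have := U1 i;
    rewrite mxE => ->; rewrite mulr1.
- by rewrite !mulmxA mulmxKV // -(mulmxA _ D) DE mulmx1.
Qed.

(** [X, Y] is the product of X Y X^-1, a conjugate of Y, and Y^-1 = Y. *)
Lemma mul_U2_mx_U2_commutator (F : fieldType) (n : nat) (A : 'M[F]_n) :
  2%N \in [pchar F] -> U2_commutator A ->
  exists X Y : 'M[F]_n, [/\ U2_mx X, U2_mx Y & A = X *m Y].
Proof.
move=> F2 [X [Y [UX UY ->]]].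
have [_ uX] := mulmx1_unit (proj1 ((U2_mxE X F2).1 UX)).
have [YY _] := (U2_mxE Y F2).1 UY; have [uY _] := mulmx1_unit YY.
rewrite /commutator_mx;
  have -> : invmx Y = Y by rewrite -[LHS]mulmx1 -YY mulKmx.
exists (X *m Y *m invmx X), Y; split=> //.
exact: U2_mx_conj.
Qed.

Theorem theorem5p4 (F : fieldType) (n : nat)
    (hn : (2 <= n)%N)
    (hchar : 2%N \in [pchar F])
    (hcard : card_at_least F (2 * (n %/ 2) + 2)%N) :
  forall A : 'M[F]_n, SL_mx A ->
    product_of_at_most 2 (@U2_commutator F n) A /\
    product_of_at_most 4 (@U2_mx F n) A.
Proof.
move=> A dA.
have [B [C [UB UC ->]]] :
    exists B C : 'M[F]_n, [/\ U2_commutator B, U2_commutator C & A = B *m C].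
  have [/is_scalar_mxP[l Al]|nA] := boolP (is_scalar_mx A); last first.
    exact: nonscalar_mul_U2_commutators.
  have ln : l ^+ n = 1 by rewrite -det_scalar -Al.
  have [n3|n2] := ltnP 2 n; first by rewrite Al;
    exact: scalar_mul_U2_commutators.
  (* Here n = 2, so l^2 = 1 and injectivity of squaring applies. *)
  have l1 : l = 1.
    apply: (sqrf_inj_pchar2 hchar); rewrite /= expr1n -ln; congr (_ ^+ _).
    by apply/eqP; rewrite eqn_leq hn.
  by exists 1%:M, 1%:M; rewrite mulmx1 Al l1; split=> //; exact: U2_commutator1.
split.
  exists [:: B; C]; rewrite !big_cons big_nil mulmx1; split=> // D.
  by rewrite !inE => /orP[]/eqP ->.
have [X [Y [UX UY ->]]] := mul_U2_mx_U2_commutator hchar UB.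
have [Z [W [UZ UW ->]]] := mul_U2_mx_U2_commutator hchar UC.
exists [:: X; Y; Z; W]; rewrite !big_cons big_nil mulmx1 !mulmxA; split=> // D.
by rewrite !inE => /or4P[]/eqP ->.
Qed.
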